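(* Let $\mathcal{F}$ be a hereditary family of graphs. The following statements are equivalent: (1) every graph in $\operatorname{obs}(\mathcal{F})$ is point-determining; (2) $\mathcal{F}$ is closed under vertex duplication; (3) for every graph $G$, $G$ is fully $\mathcal{F}$-colourable if and only if $G\in\mathcal{F}$.
   Context: Graphs are finite and undirected, with neither loops nor parallel edges, and families of graphs are closed under isomorphism. A family of graphs is hereditary if it is closed under taking induced subgraphs. $\operatorname{obs}(\mathcal{F})$ is the set of minimal $\mathcal{F}$-obstructions, i.e. graphs not in $\mathcal{F}$ all of whose proper induced subgraphs are in $\mathcal{F}$. Two distinct vertices are false twins if they are nonadjacent and have the same (open) neighbourhood; a graph is point-determining if it has no pair of false twins. Duplicating a vertex $v$ means adding a new vertex that is a false twin of $v$. A full homomorphism from $G$ to $H$ is a function $\varphi\colon V_G\to V_H$ such that, for all $u,v\in V_G$, $uv\in E_G$ if and only if $\varphi(u)\varphi(v)\in E_H$. A graph is fully $\mathcal{F}$-colourable if it admits a full homomorphism to some graph in $\mathcal{F}$. *)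

(* Defs.v *)
From mathcomp Require Import all_boot.

Set Implicit Arguments.
Unset Strict Implicit.
Unset Printing Implicit Defensive.

(* The graph with no vertices is allowed. *)
Record sgraph := SGraph {
  vertex :> finType;
  adj : rel vertex;
  adj_sym : symmetric adj;
  adj_irrefl : irreflexive adj
}.

Definition isomorphic (G H : sgraph) : Prop :=
  exists f : G -> H, bijective f /\ forall u v : G, adj (f u) (f v) = adj u v.

(* A family of graphs is a predicate on [sgraph] satisfying [iso_closed]. *)
Definition iso_closed (F : sgraph -> Prop) : Prop :=
  forall G H : sgraph, isomorphic G H -> F G -> F H.

Section Induced.
Variables (G : sgraph) (S : {set G}).

Definition induced_adj : rel {x : G | x \in S} :=
  fun x y => adj (val x) (val y).

Lemma induced_sym : symmetric induced_adj.
Proof. by move=> x y; rewrite /induced_adj adj_sym. Qed.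

Lemma induced_irrefl : irreflexive induced_adj.
Proof. by move=> x; rewrite /induced_adj adj_irrefl. Qed.

Definition induced : sgraph := SGraph induced_sym induced_irrefl.

End Induced.

Definition hereditary (F : sgraph -> Prop) : Prop :=
  forall (G : sgraph) (S : {set G}), F G -> F (induced S).

Definition obs (F : sgraph -> Prop) (G : sgraph) : Prop :=
  ~ F G /\ forall S : {set G}, S \proper [set: G] -> F (induced S).

Definition nbhd (G : sgraph) (v : G) : {set G} := [set w | adj v w].

Definition false_twins (G : sgraph) (u v : G) : Prop :=
  [/\ u != v, ~~ adj u v & nbhd u = nbhd v].

Definition point_determining (G : sgraph) : Prop :=
  forall u v : G, ~ false_twins u v.

Section Duplicate.
Variables (G : sgraph) (v : G).

(* [None] is the new vertex. *)
Definition duplicate_adj : rel (option G) := fun x y =>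
  match x, y with
  | Some a, Some b => adj a b
  | None, Some b => adj v b
  | Some a, None => adj a v
  | None, None => false
  end.

Lemma duplicate_sym : symmetric duplicate_adj.
Proof. by move=> [a|] [b|] //=; rewrite adj_sym. Qed.

Lemma duplicate_irrefl : irreflexive duplicate_adj.
Proof. by move=> [a|] //=; rewrite adj_irrefl. Qed.

Definition duplicate : sgraph := SGraph duplicate_sym duplicate_irrefl.

End Duplicate.

Lemma duplicate_false_twins (G : sgraph) (v : G) :
  @false_twins (duplicate v) (Some v) None.
Proof.
split=> //=; first by rewrite adj_irrefl.
by apply/setP=> -[a|]; rewrite !inE //= adj_irrefl.
Qed.

Definition duplication_closed (F : sgraph -> Prop) : Prop :=
  forall (G : sgraph) (v : G), F G -> F (duplicate v).

Definition full_hom (G H : sgraph) (f : G -> H) : Prop :=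
  forall u v : G, adj u v <-> adj (f u) (f v).

Definition fully_colourable (F : sgraph -> Prop) (G : sgraph) : Prop :=
  exists H : sgraph, F H /\ exists f : G -> H, full_hom f.

(* Main.v *)
Require Import Defs.
From mathcomp Require Import all_boot.
From Stdlib Require Import Classical.

Set Implicit Arguments.
Unset Strict Implicit.
Unset Printing Implicit Defensive.

(** Two vertices with the same image under a full homomorphism [f] have the
    same neighbourhood ([full_hom_eq_nbhd]).  So [f] is either an embedding as an
    induced subgraph, along which membership in a hereditary family pulls back
    ([embedding_closed]), or it identifies two false twins [u] and [v]; in that
    case the graph is the duplicate of [u] in the graph without [v]
    ([duplication_closed_twins]).

    - (1) implies (2): if the duplicate of [v] in a member [G] of the family were
      outside the family, it would contain a minimal obstruction.  Folding the
      new vertex onto [v] is a full homomorphism to [G]; on the obstruction,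
      which is point-determining, it is an embedding, so the obstruction would
      belong to the family.
    - (2) implies (1): an obstruction with false twins is recovered by
      duplicating a vertex of one of its proper induced subgraphs.
    - (2) implies (3): by induction on the order of the coloured graph, deleting
      one vertex of an identified pair until the colouring is injective; a
      member of the family is coloured by itself.
    - (3) implies (2): the folding map colours the duplicate by [G]. *)

Definition embedding (G H : sgraph) (f : G -> H) : Prop :=
  injective f /\ full_hom f.

Lemma full_hom_adj (G H : sgraph) (f : G -> H) :
  full_hom f -> forall u v : G, adj (f u) (f v) = adj u v.
Proof. by move=> hf u v; apply/idP/idP => /hf. Qed.

Lemma full_hom_comp (G H K : sgraph) (f : G -> H) (g : H -> K) :
  full_hom f -> full_hom g -> full_hom (g \o f).
Proof. by move=> hf hg u v; apply: (iff_trans (hf u v)); apply: hg. Qed.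

Definition inclusion (G : sgraph) (S : {set G}) (x : induced S) : G := sval x.

Lemma embedding_inclusion (G : sgraph) (S : {set G}) :
  embedding (@inclusion G S).
Proof. by split=> // x y; apply: val_inj. Qed.

Lemma full_hom_eq_nbhd (G H : sgraph) (f : G -> H) (u v : G) :
  full_hom f -> f u = f v -> nbhd u = nbhd v.
Proof.
move=> /full_hom_adj hf fuv; apply/setP=> w.
by rewrite !inE -!hf fuv.
Qed.

(** Looplessness forces vertices with equal open neighbourhoods to be
    nonadjacent. *)
Lemma eq_nbhd_false_twins (G : sgraph) (u v : G) :
  u != v -> nbhd u = nbhd v -> false_twins u v.
Proof.
move=> neq_uv eq_n; split=> //.
by have /setP/(_ v) := eq_n; rewrite !inE adj_irrefl => ->.
Qed.

Lemma point_determining_inj (G H : sgraph) (f : G -> H) :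
  point_determining G -> full_hom f -> injective f.
Proof.
move=> pdG hf u v fuv; apply/eqP/negPn/negP=> neq_uv.
exact: pdG (eq_nbhd_false_twins neq_uv (full_hom_eq_nbhd hf fuv)).
Qed.

(** Identifying the new vertex with the duplicated one loses no adjacency
    information. *)
Lemma full_hom_fold (G : sgraph) (v : G) :
  full_hom (odflt v : duplicate v -> G).
Proof. by move=> [a|] [b|] //=; rewrite adj_irrefl. Qed.

(** The order drops at each descent to a proper induced subgraph outside the
    family; stating the result with an embedding instead of a vertex set avoids
    induced subgraphs of induced subgraphs. *)
Lemma obs_exists (F : sgraph -> Prop) (G : sgraph) :
  ~ F G -> exists (O : sgraph) (f : O -> G), obs F O /\ embedding f.
Proof.
have [n] := ubnP #|G|; elim: n G => // n IHn G ltGn nFG.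
have [minG | nminG] :=
    classic (forall S : {set G}, S \proper [set: G] -> F (induced S)).
  by exists G, id; split; split.
have [S nimplS] := not_all_ex_not _ _ nminG.
have [properS nFS] := imply_to_and _ _ nimplS.
have ltSn : #|induced S| < n.
  by rewrite card_sig -ltnS (leq_trans _ ltGn) // ltnS -cardsT proper_card.
have [O [f [obsO [inj_f hf]]]] := IHn _ ltSn nFS.
have [inj_incl hincl] := embedding_inclusion S.
exists O, (@inclusion G S \o f); split=> //; split; first exact: inj_comp.
exact: full_hom_comp hincl.
Qed.

(** An embedded graph is isomorphic to the subgraph induced by its image. *)
Lemma embedding_closed (F : sgraph -> Prop) :
  iso_closed F -> hereditary F ->
  forall (G H : sgraph) (f : G -> H), embedding f -> F H -> F G.
Proof.
move=> isoF herF G H f [inj_f /full_hom_adj hf] FH.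
pose S := [set f x | x : G].
have memS x : f x \in S by apply: imset_f.
pose g (x : G) : induced S := exist _ (f x) (memS x).
have bij_g : bijective g.
  apply: inj_card_bij => [x y /(congr1 val) /inj_f //|].
  by rewrite card_sig card_imset.
have [h gK hK] := bij_g.
apply: (isoF (induced S) G); last exact: herF.
exists h; split; first by exists g.
by move=> x y; rewrite -hf -{2}[x]hK -{2}[y]hK.
Qed.

(** Deleting [v] and then duplicating [u] restores the graph, the new vertex
    standing for [v]. *)
Lemma duplication_closed_twins (F : sgraph -> Prop) :
  iso_closed F -> hereditary F -> duplication_closed F ->
  forall (G : sgraph) (u v : G),
    u != v -> nbhd u = nbhd v -> F (induced [set~ v]) -> F G.
Proof.
move=> isoF herF dupF G u v neq_uv eq_n FGv.
have mem_u : u \in [set~ v] by rewrite !inE.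
pose u' : induced [set~ v] := exist _ u mem_u.
have adj_uv w : adj u w = adj v w by have /setP/(_ w) := eq_n; rewrite !inE.
(* The partial inverse of the inclusion of G - v is undefined exactly at v, so
   its value None there is the new vertex of the duplicate. *)
pose g : G -> duplicate u' := fun x => insub x.
have foldg x : inclusion (odflt u' (g x)) = if x == v then u else x.
  rewrite /g; case: insubP => [y|] /=; rewrite !inE; first by move/negPf=> ->.
  by rewrite negbK => ->.
have hfold :=
  full_hom_comp (@full_hom_fold _ u') (embedding_inclusion [set~ v]).2.
apply: (embedding_closed isoF herF (f := g) _ (dupF _ u' FGv)); split.
  move=> x y; rewrite /g.
  case: insubP => [x' _ <-|]; case: insubP => [y' _ <-|] //=.
    by move=> [->].
  by rewrite !inE !negbK => /eqP -> /eqP ->.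
move=> x y.
(* By foldg, adjacency of g x and g y is adjacency of x and y with v replaced
   by its twin u. *)
rewrite -(full_hom_adj hfold) /comp !foldg.
case: (x =P v) => [->|_]; case: (y =P v) => [->|_] //.
- by rewrite !adj_irrefl.
- by rewrite adj_uv.
- by rewrite adj_sym -adj_uv adj_sym.
Qed.

Lemma obs_point_determining_duplication_closed (F : sgraph -> Prop) :
  iso_closed F -> hereditary F ->
  (forall G : sgraph, obs F G -> point_determining G) -> duplication_closed F.
Proof.
move=> isoF herF pdF G v FG; apply: NNPP => nF.
have [O [f [obsO [_ hf]]]] := obs_exists nF.
have hfold := full_hom_comp hf (@full_hom_fold G v).
have inj_fold := point_determining_inj (pdF O obsO) hfold.
case: (obsO) => nFO _; apply: nFO.
exact: (embedding_closed isoF herF (conj inj_fold hfold) FG).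
Qed.

Lemma duplication_closed_obs_point_determining (F : sgraph -> Prop) :
  iso_closed F -> hereditary F -> duplication_closed F ->
  forall G : sgraph, obs F G -> point_determining G.
Proof.
move=> isoF herF dupF G [nFG minG] u v [neq_uv _ eq_n]; apply: nFG.
apply: (duplication_closed_twins isoF herF dupF neq_uv eq_n).
apply: minG; rewrite properEneq subsetT andbT -setC0.
by rewrite (inj_eq (@setC_inj _)) -card_gt0 cards1.
Qed.

Lemma duplication_closed_colourable (F : sgraph -> Prop) :
  iso_closed F -> hereditary F -> duplication_closed F ->
  forall G : sgraph, fully_colourable F G -> F G.
Proof.
move=> isoF herF dupF G [H [FH [f hf]]].
have [n] := ubnP #|G|; elim: n G f hf => // n IHn G f hf ltGn.
have [/injectiveP inj_f | /injectivePn [u [v neq_uv fuv]]] :=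
    boolP (injectiveb f).
  exact: (embedding_closed isoF herF (conj inj_f hf) FH).
have eq_n := full_hom_eq_nbhd hf fuv.
apply: (duplication_closed_twins isoF herF dupF neq_uv eq_n).
apply: (IHn _ (f \o @inclusion G [set~ v])).
  exact: full_hom_comp (embedding_inclusion _).2 hf.
rewrite card_sig -ltnS (leq_trans _ ltGn) // ltnS.
by rewrite cardsC1 ltn_predL; apply/card_gt0P; exists v.
Qed.

Lemma colourable_duplication_closed (F : sgraph -> Prop) :
  (forall G : sgraph, fully_colourable F G -> F G) -> duplication_closed F.
Proof.
move=> colF G v FG; apply: colF; exists G; split=> //.
exists (odflt v); exact: full_hom_fold.
Qed.

Theorem proposition4 (F : sgraph -> Prop)
    (F_iso : iso_closed F) (F_hereditary : hereditary F) :
  ((forall G : sgraph, obs F G -> point_determining G) <->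
     duplication_closed F) /\
  (duplication_closed F <->
     (forall G : sgraph, fully_colourable F G <-> F G)).
Proof.
split; split.
- exact: obs_point_determining_duplication_closed.
- exact: duplication_closed_obs_point_determining.
- move=> dupF G; split; first exact: duplication_closed_colourable.
  by move=> FG; exists G; split=> //; exists id.
- move=> colF; apply: colourable_duplication_closed => G; exact: (colF G).1.
Qed.
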